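(* Let $X$ be a Hausdorff space, and let $G$ be a countable group of homeomorphisms of $X$. Assume that for every non-empty open set $U\subset X$, the rigid stabilizer $G_U$ is non-amenable. Then $G$ is $C^\ast$-simple.
   Context: For $U\subset X$, the rigid stabilizer $G_U$ is the subgroup of $G$ consisting of elements that fix $X\setminus U$ pointwise. A group $G$ is $C^\ast$-simple if its reduced $C^\ast$-algebra $C^\ast_{red}(G)$ is simple. *)

(* Defs.v *)
From HB Require Import structures.
From mathcomp Require Import all_boot all_order all_algebra.
From mathcomp Require Import all_classical all_reals all_analysis.
From mathcomp Require Import complex ring.

Set Implicit Arguments.
Unset Strict Implicit.
Unset Printing Implicit Defensive.

Import Order.TTheory GRing.Theory Num.Theory.

Local Open Scope classical_set_scope.
Local Open Scope ring_scope.
Local Open Scope complex_scope.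

Record homeo (X : topologicalType) := Homeo {
  homeo_fun :> X -> X;
  homeo_inv : X -> X;
  homeo_funK : cancel homeo_fun homeo_inv;
  homeo_invK : cancel homeo_inv homeo_fun;
  homeo_fun_continuous : continuous homeo_fun;
  homeo_inv_continuous : continuous homeo_inv }.

Section HomeoGroup.
Variable X : topologicalType.
Implicit Types f g h : homeo X.

HB.instance Definition _ := gen_eqMixin (homeo X).
HB.instance Definition _ := gen_choiceMixin (homeo X).

Lemma homeo_ext f g : f =1 g -> f = g.
Proof.
case: f g => [f f' fK f'K fC f'C] [g g' gK g'K gC g'C] /= /funext fg.
have fg' : f' = g' by apply/funext => x; apply: (can_inj fK); rewrite f'K fg g'K.
subst g g'; congr Homeo; exact: Prop_irrelevance.
Qed.

Definition homeo_one : homeo X :=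
  @Homeo X idfun idfun (fun=> erefl) (fun=> erefl)
    (fun x => cvg_id) (fun x => cvg_id).

Definition homeo_opp f : homeo X :=
  Homeo (@homeo_invK X f) (@homeo_funK X f)
    (@homeo_inv_continuous X f) (@homeo_fun_continuous X f).

Definition homeo_mul f g : homeo X :=
  @Homeo X (f \o g) (homeo_inv g \o homeo_inv f)
    (can_comp (@homeo_funK X f) (@homeo_funK X g))
    (can_comp (@homeo_invK X g) (@homeo_invK X f))
    (fun x => continuous_comp (@homeo_fun_continuous X g x)
                              (@homeo_fun_continuous X f (g x)))
    (fun x => continuous_comp (@homeo_inv_continuous X f x)
                (@homeo_inv_continuous X g (homeo_inv f x))).

Fact homeo_mulA : associative homeo_mul.
Proof. by move=> f g h; apply: homeo_ext. Qed.

Fact homeo_mul1 : left_id homeo_one homeo_mul.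
Proof. by move=> f; apply: homeo_ext. Qed.

Fact homeo_mulr1 : right_id homeo_one homeo_mul.
Proof. by move=> f; apply: homeo_ext. Qed.

Fact homeo_mulV : left_inverse homeo_one homeo_opp homeo_mul.
Proof. by move=> f; apply: homeo_ext => x /=; rewrite homeo_funK. Qed.

Fact homeo_mulrV : right_inverse homeo_one homeo_opp homeo_mul.
Proof. by move=> f; apply: homeo_ext => x /=; rewrite homeo_invK. Qed.

HB.instance Definition _ := isGroup.Build (homeo X)
  homeo_mulA homeo_mul1 homeo_mulr1 homeo_mulV homeo_mulrV.

End HomeoGroup.

Section Subgroup.
Variables (gT : groupType) (H : groupClosed gT).

Definition subgroup : Type := {x : gT | x \in H}.

HB.instance Definition _ := SubChoice.on subgroup.

Fact subgroup_closed : group_closed [in H].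
Proof. by split=> [|x y xH yH]; [exact: gpred1 | exact: gpredF]. Qed.

HB.instance Definition _ :=
  SubChoice_isSubGroup.Build gT [in H] subgroup subgroup_closed.

End Subgroup.

Section RigidStabilizer.
Variables (X : topologicalType) (G : groupClosed (homeo X)) (U : set X).

Definition rist : {pred homeo X} :=
  [pred g | (g \in G) && `[< forall x, (~` U) x -> g x = x >]].

Fact rist_mul : mulg_closed rist.
Proof.
move=> f g /andP[fG /asboolP fU] /andP[gG /asboolP gU].
apply/andP; split; first exact: gpredM.
by apply/asboolP => x xU /=; rewrite gU// fU.
Qed.

Fact rist_one : 1%g \in rist.
Proof. by apply/andP; split; [exact: gpred1 | exact/asboolP]. Qed.

Fact rist_inv : invg_closed rist.
Proof.
move=> f /andP[fG /asboolP fU]; apply/andP; split; first exact: gpredVr.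
by apply/asboolP => x xU /=; rewrite -[X in homeo_inv f X](fU x xU) homeo_funK.
Qed.

HB.instance Definition _ := isMulClosed.Build (homeo X) rist rist_mul.
HB.instance Definition _ := isMul1Closed.Build (homeo X) rist rist_one.
HB.instance Definition _ := isInvClosed.Build (homeo X) rist rist_inv.

End RigidStabilizer.

(* Amenability as a discrete group; the measure of a set is only finitely
   additive, and every subset is measurable. *)
Definition amenable (R : realType) (G : groupType) : Prop :=
  exists mu : set G -> R,
    [/\ forall A, 0 <= mu A,
        mu setT = 1,
        forall A B, A `&` B = set0 -> mu (A `|` B) = mu A + mu B
      & forall g A, mu [set (g * x)%g | x in A] = mu A].

Section Ell2.
Variables (R : realType) (I : choiceType).
Implicit Types f g : I -> R[i].

Definition sqmod (z : R[i]) : R := complex.Re z ^+ 2 + complex.Im z ^+ 2.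

Fact sqmod_ge0 z : 0 <= sqmod z.
Proof. by rewrite addr_ge0 ?sqr_ge0. Qed.

Fact sqmodM z w : sqmod (z * w) = sqmod z * sqmod w.
Proof. by case: z w => [a b] [c d]; rewrite /sqmod /=; ring. Qed.

Fact sqmodD z w : sqmod (z + w) <= (sqmod z + sqmod z) + (sqmod w + sqmod w).
Proof.
case: z w => [a b] [c d]; rewrite /sqmod /= -subr_ge0.
rewrite (_ : _ - _ = (a - c) ^+ 2 + (b - d) ^+ 2); last by ring.
by rewrite addr_ge0 ?sqr_ge0.
Qed.

Definition sqsum f : \bar R := \esum_(i in [set: I]) (sqmod (f i))%:E.

Definition sqsummable : {pred I -> R[i]} := [pred f | `[< (sqsum f < +oo)%E >]].

Fact sqsummable_submod : submod_closed sqsummable.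
Proof.
have nnE (h : I -> R[i]) i : (0 <= (sqmod (h i))%:E :> \bar R)%E.
  by rewrite lee_fin sqmod_ge0.
split=> [|a f g /asboolP fP /asboolP gP]; apply/asboolP.
  by rewrite /sqsum esum1 ?ltry// => i _; rewrite /sqmod /= !expr0n/= addr0.
have afP : (sqsum (fun i => (a * f i)%R) < +oo)%E.
  apply: (@le_lt_trans _ _ ((sqmod a)%:E * sqsum f)%E); last first.
    by rewrite lte_mul_pinfty ?lee_fin ?sqmod_ge0.
  apply: ge_ereal_sup => _ [A AI <-].
  under eq_fsbigr do rewrite sqmodM EFinM.
  rewrite -ge0_mule_fsumr//; apply: lee_wpmul2l; first by rewrite lee_fin sqmod_ge0.
  by apply: ereal_sup_ubound; exists A.
pose F (h : I -> R[i]) i := (sqmod (h i))%:E.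
pose af i := a * f i.
apply: (@le_lt_trans _ _
    (\esum_(i in [set: I]) ((F af i + F af i) + (F g i + F g i)))%E).
  by apply: le_esum => i _; rewrite -!EFinD lee_fin sqmodD.
rewrite !esumD => [||||||]; by [
  rewrite !lte_add_pinfty | move=> i _; rewrite ?adde_ge0 ?nnE].
Qed.

HB.instance Definition _ := GRing.isSubmodClosed.Build R[i] (I -> R[i])
  sqsummable sqsummable_submod.

Definition ell2 : Type := {f : I -> R[i] | f \in sqsummable}.

HB.instance Definition _ := SubChoice.on ell2.
HB.instance Definition _ := [SubChoice_isSubLmodule of ell2 by <:].

Definition ell2norm (x : ell2) : R := Num.sqrt (fine (sqsum (val x))).

Definition opnorm (T : ell2 -> ell2) : \bar R :=
  ereal_sup [set (ell2norm (T x))%:E | x in [set x | ell2norm x <= 1]].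

Definition bounded_operator (T : ell2 -> ell2) : Prop :=
  linear T /\ (opnorm T < +oo)%E.

(* The closure of [A] for the operator norm, taken in the algebra of bounded
   operators. *)
Definition opclosure (A : set (ell2 -> ell2)) : set (ell2 -> ell2) :=
  [set T | bounded_operator T /\
    forall e : R, 0 < e -> exists2 S, A S & (opnorm (T - S)%R <= e%:E)%E].

End Ell2.

Section ReducedCstar.
Variables (R : realType) (G : groupType).
Local Notation H := (ell2 R G).

Fact leftreg_subproof (g : G) (x : H) :
  (fun h => val x (g^-1 * h)%g) \in @sqsummable R G.
Proof.
have /asboolP xP := valP x; apply/asboolP; apply: le_lt_trans xP.
rewrite /sqsum (@reindex_esum _ _ _ setT setT (fun h => g * h)%g)//.
- by apply: le_esum => i _; rewrite mulKg.
- split=> // [h k _ _ /(congr1 (fun z => g^-1 * z)%g)|h _]; first by rewrite !mulKg.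
  by exists (g^-1 * h)%g => //; rewrite mulVKg.
Qed.

Definition leftreg (g : G) (x : H) : H :=
  exist _ (fun h => val x (g^-1 * h)%g) (leftreg_subproof g x).

Definition leftreg_span : set (H -> H) :=
  [set T | exists (s : seq G) (c : G -> R[i]),
             T = \sum_(g <- s) c g *: leftreg g].

(* [leftreg_span] is closed under adjoints, since the adjoint of [leftreg g] is
   [leftreg g^-1]: its norm closure is the C*-algebra generated by the
   operators [leftreg g]. *)
Definition Cstar_red : set (H -> H) := opclosure leftreg_span.

Definition closed_ideal (A I : set (H -> H)) : Prop :=
  [/\ I `<=` A,
      I 0,
      forall S T, I S -> I T -> I (S + T),
      forall (c : R[i]) T, I T -> I (c *: T)
    & [/\ forall S T, A S -> I T -> I (S \o T),
          forall S T, I S -> A T -> I (S \o T)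
        & A `&` opclosure I `<=` I]].

(* [Cstar_red] is nonzero, as it contains the identity. *)
Definition Cstar_simple : Prop :=
  forall I, closed_ideal Cstar_red I -> I = [set 0] \/ I = Cstar_red.

End ReducedCstar.

(* Main.v *)
Require Import Defs.
From HB Require Import structures.
From mathcomp Require Import all_boot all_order all_algebra.
From mathcomp Require Import all_classical all_reals all_analysis.
From mathcomp Require Import complex ring.

(** The proof goes through Powers' averaging property: for finitely many nontrivial
    elements $f_1, \dots, f_k$ of $G$ and $\varepsilon > 0$ there is a finite
    average over $g$ for which all the operators obtained by averaging
    $\lambda(g f_i g^{-1})$ have norm at most $\varepsilon$.

    The property implies simplicity ([Cstar_simple_of_powers]). A nonzero closed
    ideal contains an element of trace $1$; averaging its conjugates stays in the
    ideal, preserves the trace, and makes everything else small, so the identity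
    is a limit of elements of the ideal.

    The property holds ([powers_averaging]) for the following reason. A nontrivial
    $f$ displaces some nonempty open set $U$, by the Hausdorff property. For $g$ in
    the rigid stabilizer $G_U$ write
    $g f g^{-1} = g \, (f g^{-1} f^{-1}) \, f$. The middle factor is supported in
    $f(U)$, off $U$, so it lies in a subgroup $L$ that commutes with $G_U$ and meets
    it trivially. Hence $\ell^2(G)$ splits over the cosets of $G_U L$, and forgetting
    the $L$-coordinate by taking $\ell^2$ norms along it shows that the average of
    the operators $\lambda(g f g^{-1})$ is no larger than the average of the
    translations by $g$ on $\ell^2(G_U)$ ([opbound_average_fold],
    [equivariant_coordinate]). Since $G_U$ is not amenable, the latter can be made
    arbitrarily small ([kesten]).

    Several elements are treated together by shrinking $U$ until each of them
    either displaces $U$ or acts trivially on it ([displaces_or_fixes]): the first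
    kind is made small by one average over $G_U$, the second kind commutes with
    $G_U$ and is left for an induction on the number of elements. *)

Set Implicit Arguments.
Unset Strict Implicit.
Unset Printing Implicit Defensive.

Import Order.TTheory GRing.Theory Num.Theory.
Import numFieldNormedType.Exports.

Local Open Scope classical_set_scope.
Local Open Scope ring_scope.
Local Open Scope complex_scope.

(** * Square sums, vectors and operator bounds *)

Section SquareSums.
Variables (R : realType) (I : choiceType).
Implicit Types (D : set I) (f g : I -> R[i]).

(** Square sums over subsets are needed twice: as masses of sets when a vector is
    turned into a mean, and fibre by fibre when a vector is folded along a map. *)
Definition sqsum_on D f : \bar R := \esum_(i in D) (sqmod (f i))%:E.

Lemma sqmod_lee_ge0 (z : R[i]) : (0 <= (sqmod z)%:E)%E.
Proof. by rewrite lee_fin sqmod_ge0. Qed.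

Lemma sqsum_on_ge0 D f : (0 <= sqsum_on D f)%E.
Proof. by apply: esum_ge0 => i _; exact: sqmod_lee_ge0. Qed.

Lemma sqmod_le_sqsum_on D f i : D i -> ((sqmod (f i))%:E <= sqsum_on D f)%E.
Proof.
move=> Di; apply: esum_ge; exists [set i]; last by rewrite fsbig_set1.
by split=> [|_ ->].
Qed.

Lemma sqmod_eq0 (z : R[i]) : sqmod z <= 0 -> z = 0.
Proof.
case: z => a b; rewrite /sqmod /= => ab0.
have /eqP : a ^+ 2 + b ^+ 2 = 0 by apply/eqP; rewrite eq_le ab0 addr_ge0 ?sqr_ge0.
by rewrite paddr_eq0 ?sqr_ge0// !sqrf_eq0 => /andP[/eqP-> /eqP->].
Qed.

Lemma sqmod_real (r : R) : sqmod r%:C = r ^+ 2.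
Proof. by rewrite /sqmod /= expr0n addr0. Qed.

Lemma le_esumZ D (F : I -> \bar R) (c : R) : 0 <= c ->
  (forall i, 0 <= F i)%E ->
  (\esum_(i in D) (c%:E * F i) <= c%:E * \esum_(i in D) F i)%E.
Proof.
move=> c0 F0; apply: ge_ereal_sup => _ [A AD <-].
rewrite -ge0_mule_fsumr//; apply: lee_wpmul2l; first by rewrite lee_fin.
by apply: ereal_sup_ubound; exists A.
Qed.

(** The defect of this inequality is $|tz-sw|^2/(st)$. *)
Lemma sqmod_split (s t : R) (z w : R[i]) : 0 < s -> 0 < t ->
  sqmod (z + w) <= (1 + t / s) * sqmod z + (1 + s / t) * sqmod w.
Proof.
move=> s0 t0; have sn : s != 0 by rewrite gt_eqF. have tn : t != 0 by rewrite gt_eqF.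
case: z w => [a b] [c d]; rewrite /sqmod /= -subr_ge0.
rewrite (_ : _ - _ = ((t * a - s * c) ^+ 2 + (t * b - s * d) ^+ 2) / (s * t)).
  by rewrite divr_ge0 ?addr_ge0 ?sqr_ge0 ?mulr_ge0 ?ltW.
by field; rewrite tn sn.
Qed.

Lemma sqsum_on_split D f g (s t : R) : 0 < s -> 0 < t ->
  (sqsum_on D (fun i => f i + g i)%R
     <= (1 + t / s)%:E * sqsum_on D f + (1 + s / t)%:E * sqsum_on D g)%E.
Proof.
move=> s0 t0.
have c0 : 0 <= 1 + t / s by rewrite addr_ge0// divr_ge0 ?ltW.
have d0 : 0 <= 1 + s / t by rewrite addr_ge0// divr_ge0 ?ltW.
apply: (@le_trans _ _ (\esum_(i in D) ((1 + t / s)%:E * (sqmod (f i))%:E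
     + (1 + s / t)%:E * (sqmod (g i))%:E)))%E.
  by apply: le_esum => i _; rewrite -!EFinM -EFinD lee_fin sqmod_split.
rewrite esumD => [|i _|i _]; try by rewrite mule_ge0 ?sqmod_lee_ge0 ?lee_fin.
by apply: leeD; apply: le_esumZ => // i; exact: sqmod_lee_ge0.
Qed.

(** Minkowski's inequality, obtained from the weighted inequality above with the
    weights adapted to the two bounds; when a bound is $0$ the function vanishes. *)
Lemma sqsum_onD_le D f g (a b : R) : 0 <= a -> 0 <= b ->
  (sqsum_on D f <= (a ^+ 2)%:E)%E -> (sqsum_on D g <= (b ^+ 2)%:E)%E ->
  (sqsum_on D (fun i => f i + g i)%R <= ((a + b) ^+ 2)%:E)%E.
Proof.
have null h i : D i -> (sqsum_on D h <= (0 ^+ 2)%:E)%E -> h i = 0.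
  move=> Di; rewrite expr0n/= => /(le_trans (sqmod_le_sqsum_on h Di)).
  by rewrite lee_fin => /sqmod_eq0.
rewrite !le_eqVlt; move=> /predU1P[<-|a0] /predU1P[<-|b0]; rewrite -!le_eqVlt => fa gb.
- rewrite addr0; apply: le_trans gb; apply: le_esum => i Di.
  by rewrite (null f i)// add0r.
- rewrite add0r; apply: le_trans gb; apply: le_esum => i Di.
  by rewrite (null f i)// add0r.
- rewrite addr0; apply: le_trans fa; apply: le_esum => i Di.
  by rewrite (null g i)// addr0.
apply: (le_trans (sqsum_on_split D f g a0 b0)).
apply: (@le_trans _ _ ((1 + b / a)%:E * (a ^+ 2)%:E + (1 + a / b)%:E * (b ^+ 2)%:E)%E).
  by apply: leeD; apply: lee_wpmul2l => //; rewrite lee_fin addr_ge0// divr_ge0 ?ltW.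
rewrite -!EFinM -EFinD lee_fin.
have an : a != 0 by rewrite gt_eqF. have bn : b != 0 by rewrite gt_eqF.
by rewrite le_eqVlt; apply/orP; left; apply/eqP; field; rewrite an bn.
Qed.

Lemma sqsum_on_sum_le (T : Type) D (s : seq T) (F : T -> I -> R[i]) (a : T -> R) :
  (forall t, 0 <= a t) -> (forall t, sqsum_on D (F t) <= (a t ^+ 2)%:E)%E ->
  (sqsum_on D (fun i => \sum_(t <- s) F t i)%R <= ((\sum_(t <- s) a t) ^+ 2)%:E)%E.
Proof.
move=> a0 Fa; elim: s => [|t s IH].
  rewrite big_nil expr0n/= /sqsum_on esum1// => i _.
  by rewrite big_nil /sqmod/= expr0n addr0.
rewrite big_cons.
under [X in sqsum_on D X]eq_fun do rewrite big_cons.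
by apply: sqsum_onD_le => //; exact: sumr_ge0.
Qed.

Lemma sqsum_onZ D (c : R[i]) f :
  (sqsum_on D (fun i => c * f i)%R <= (sqmod c)%:E * sqsum_on D f)%E.
Proof.
rewrite /sqsum_on; under eq_esum do rewrite sqmodM EFinM.
by apply: le_esumZ => [|i]; rewrite ?sqmod_ge0 ?sqmod_lee_ge0.
Qed.

End SquareSums.

Section Ell2Norm.
Variables (R : realType) (I : choiceType).
Local Notation H := (ell2 R I).
Implicit Types (x y : H) (T S : H -> H).

Lemma ell2norm_ge0 x : 0 <= ell2norm x.
Proof. exact: sqrtr_ge0. Qed.

Lemma ell2norm_sqr x : ((ell2norm x) ^+ 2)%:E = sqsum (val x).
Proof.
have x0 : (0 <= sqsum (val x))%E := sqsum_on_ge0 setT (val x).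
have /asboolP xf := valP x.
by rewrite sqr_sqrtr ?fine_ge0// fineK// ge0_fin_numE.
Qed.

Lemma ell2norm_le x (c : R) : 0 <= c ->
  (ell2norm x <= c) = (sqsum (val x) <= (c ^+ 2)%:E)%E.
Proof. by move=> c0; rewrite -ell2norm_sqr lee_fin ler_sqr ?nnegrE ?ell2norm_ge0. Qed.

Lemma ell2DE x y i : val (x + y) i = val x i + val y i.
Proof. by rewrite raddfD. Qed.

Lemma ell2ZE (a : R[i]) x i : val (a *: x) i = a * val x i.
Proof. by rewrite linearZ. Qed.

Lemma ell2NE x i : val (- x) i = - val x i.
Proof. by rewrite raddfN. Qed.

Lemma ell2_sumE (J : Type) (s : seq J) (F : J -> H) i :
  val (\sum_(j <- s) F j) i = \sum_(j <- s) val (F j) i.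
Proof. by rewrite raddf_sum fct_sumE. Qed.

Lemma ell2normD x y : ell2norm (x + y) <= ell2norm x + ell2norm y.
Proof.
rewrite ell2norm_le ?addr_ge0 ?ell2norm_ge0//.
rewrite /sqsum; under eq_esum do rewrite ell2DE.
by apply: sqsum_onD_le; rewrite ?ell2norm_ge0// ell2norm_sqr.
Qed.

(** The modulus with values in the real field; the norm of [R[i]] is valued in
    [R[i]] itself. *)
Definition cmod (z : R[i]) : R := Num.sqrt (sqmod z).

Lemma cmod_ge0 z : 0 <= cmod z. Proof. exact: sqrtr_ge0. Qed.

Lemma cmodC (r : R) : 0 <= r -> cmod r%:C = r.
Proof. by move=> r0; rewrite /cmod /sqmod /= expr0n addr0 sqrtr_sqr ger0_norm. Qed.

Lemma cmod_sqr (z : R[i]) : cmod z ^+ 2 = sqmod z.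
Proof. by rewrite sqr_sqrtr ?sqmod_ge0. Qed.

Lemma cmodM (z w : R[i]) : cmod (z * w) = cmod z * cmod w.
Proof. by rewrite /cmod sqmodM sqrtrM ?sqmod_ge0. Qed.

Lemma cmod_sum (J : Type) (r : seq J) (z : J -> R[i]) :
  cmod (\sum_(j <- r) z j) <= \sum_(j <- r) cmod (z j).
Proof.
elim/big_rec2: _ => [|j a b _ ab]; first by rewrite /cmod /sqmod/= expr0n addr0 sqrtr0.
apply: le_trans (lerD (lexx _) ab).
rewrite -ler_sqr ?nnegrE ?addr_ge0 ?cmod_ge0// cmod_sqr -lee_fin.
(* The triangle inequality is Minkowski's inequality over a one-point set. *)
have := @sqsum_onD_le R unit [set tt] (fun=> z j) (fun=> b) (cmod (z j)) (cmod b).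
by rewrite /sqsum_on !esum_set1 ?sqmod_lee_ge0// !cmod_sqr; apply; rewrite ?cmod_ge0.
Qed.

Lemma ell2normZ (a : R[i]) x : ell2norm (a *: x) <= cmod a * ell2norm x.
Proof.
rewrite ell2norm_le ?mulr_ge0 ?cmod_ge0 ?ell2norm_ge0//.
rewrite exprMn EFinM ell2norm_sqr sqr_sqrtr ?sqmod_ge0//.
rewrite /sqsum; under eq_esum do rewrite ell2ZE.
exact: sqsum_onZ.
Qed.

Lemma ell2normN x : ell2norm (- x) = ell2norm x.
Proof.
rewrite /ell2norm /sqsum; congr (Num.sqrt (fine _)); apply: eq_esum => i _.
by rewrite ell2NE; case: (val x i) => a b; rewrite /sqmod/= !sqrrN.
Qed.

Lemma ell2norm0 : ell2norm (0 : H) = 0.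
Proof.
apply/eqP; rewrite eq_le ell2norm_ge0 andbT.
by have := ell2normZ 0 (0 : H); rewrite scaler0 /cmod /sqmod/= expr0n addr0 sqrtr0 mul0r.
Qed.

Lemma ell2_coord x i : sqmod (val x i) <= ell2norm x ^+ 2.
Proof. by rewrite -lee_fin ell2norm_sqr; exact: sqmod_le_sqsum_on. Qed.

Lemma ell2norm_eq0 x : ell2norm x <= 0 -> x = 0.
Proof.
move=> x0; have {}x0 : ell2norm x = 0 by apply/eqP; rewrite eq_le x0 ell2norm_ge0.
apply: val_inj; apply/funext => i; apply: sqmod_eq0.
by have := ell2_coord x i; rewrite x0 expr0n.
Qed.

(** Operator norm bounds are handled through this predicate rather than [opnorm],
    so that no supremum has to be computed. *)
Definition opbound T (c : R) : Prop := forall x, ell2norm (T x) <= c * ell2norm x.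

Lemma opboundW T c d : c <= d -> opbound T c -> opbound T d.
Proof. by move=> cd Tc x; apply: (le_trans (Tc x)); rewrite ler_wpM2r ?ell2norm_ge0. Qed.

Lemma opboundD T S c d : opbound T c -> opbound S d -> opbound (T + S) (c + d).
Proof. by move=> Tc Sd x; apply: (le_trans (ell2normD _ _)); rewrite mulrDl lerD. Qed.

Lemma opboundZ (a : R[i]) T c : opbound T c -> opbound (a *: T) (cmod a * c).
Proof.
move=> Tc x; apply: (le_trans (ell2normZ _ _)).
by rewrite -mulrA ler_wpM2l ?cmod_ge0.
Qed.

Lemma opbound0 c : 0 <= c -> opbound 0 c.
Proof. by move=> c0 x; rewrite ell2norm0 mulr_ge0 ?ell2norm_ge0. Qed.

Lemma opbound_sum (J : eqType) (s : seq J) (F : J -> H -> H) (c : J -> R) :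
  (forall j, j \in s -> opbound (F j) (c j)) ->
  opbound (\sum_(j <- s) F j) (\sum_(j <- s) c j).
Proof.
move=> Fc; rewrite big_seq [X in opbound _ X]big_seq.
by elim/big_rec2: _ => [|j d T js Td]; [exact: opbound0|apply: opboundD => //; exact: Fc].
Qed.

Lemma opbound_comp T S c d : 0 <= c -> opbound T c -> opbound S d -> opbound (T \o S) (c * d).
Proof.
by move=> c0 Tc Sd x; apply: (le_trans (Tc _)); rewrite -mulrA ler_wpM2l.
Qed.

(** Probability measures on a group are represented by sequences: a uniform
    average over a sequence with repetitions is enough, because such averages are
    closed under convolution. *)
Definition average (J : Type) (V : lmodType R[i]) (s : seq J) (F : J -> V) : V :=
  ((size s)%:R^-1)%:C *: \sum_(j <- s) F j.

Lemma opbound_average (J : eqType) (s : seq J) (F : J -> H -> H) (c : R) :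
  s != [::] -> (forall j, j \in s -> opbound (F j) c) -> opbound (average s F) c.
Proof.
move=> s0 Fc; have sn : (size s)%:R != 0 :> R by rewrite pnatr_eq0 size_eq0.
have -> : c = cmod (((size s)%:R^-1)%:C) * \sum_(j <- s) c.
  by rewrite cmodC ?invr_ge0// big_const_seq count_predT iter_addr_0 -[c *+ _]mulr_natl mulKf.
by apply: opboundZ; apply: opbound_sum.
Qed.

Lemma opbound_opnorm T c : 0 <= c -> opbound T c -> (opnorm T <= c%:E)%E.
Proof.
move=> c0 Tc; apply: ge_ereal_sup => _ [x /= x1 <-]; rewrite lee_fin.
by apply: (le_trans (Tc x)); rewrite -[leRHS]mulr1 ler_wpM2l.
Qed.

(** [opnorm] is a supremum over the unit ball, so linearity enters by rescaling. *)
Lemma opnorm_opbound T c : linear T -> 0 <= c -> (opnorm T <= c%:E)%E -> opbound T c.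
Proof.
move=> Tlin c0 Tc x.
have TZ a y : T (a *: y) = a *: T y.
  have T0 : T 0 = 0 by have := Tlin (-1) 0 0; rewrite !scaleN1r oppr0 add0r addNr.
  by have := Tlin a y 0; rewrite T0 !addr0.
have [x0|xn] := eqVneq (ell2norm x) 0.
  have -> : x = 0 by apply: ell2norm_eq0; rewrite x0.
  by rewrite -[X in T X](scale0r 0) TZ scale0r ell2norm0 mulr0.
have xgt : 0 < ell2norm x by rewrite lt_def xn ell2norm_ge0.
set n := ell2norm x in xn xgt *.
pose y := (n^-1)%:C *: x.
have y1 : ell2norm y <= 1.
  by apply: (le_trans (ell2normZ _ _)); rewrite cmodC ?invr_ge0 ?(ltW xgt)// -/n mulVf.
have -> : x = n%:C *: y by rewrite scalerA -rmorphM/= mulfV// scale1r.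
rewrite TZ; apply: (le_trans (ell2normZ _ _)); rewrite cmodC ?(ltW xgt)//.
rewrite mulrC ler_pM2r// -lee_fin; apply: le_trans Tc.
by apply: ereal_sup_ubound; exists y.
Qed.

End Ell2Norm.

(** * Averages and left translations *)

Section Averages.
Variables (R : realType).

(** Convolution of two averages is iterated averaging. *)
Lemma average_allpairs (J1 J2 J : eqType) (V : lmodType R[i]) (s : seq J1) (t : seq J2)
    (f : J1 -> J2 -> J) (F : J -> V) :
  average [seq f i j | i <- s, j <- t] F =
  average s (fun i => average t (fun j => F (f i j))).
Proof.
rewrite /average size_allpairs natrM invfM rmorphM/= -scalerA; congr (_ *: _).
by rewrite big_allpairs_dep scaler_sumr.
Qed.

Lemma averageE (J U : Type) (V : lmodType R[i]) (s : seq J) (F : J -> U -> V) u :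
  average s F u = average s (fun j => F j u).
Proof. by rewrite /average -[LHS]/(_ *: ((\sum_(j <- s) F j) u)) fct_sumE. Qed.

Lemma average_coord (J : Type) (I : choiceType) (s : seq J) (F : J -> ell2 R I) i :
  val (average s F) i = ((size s)%:R^-1)%:C * \sum_(j <- s) val (F j) i.
Proof. by rewrite ell2ZE ell2_sumE. Qed.

Lemma eq_average (J : eqType) (V : lmodType R[i]) (s : seq J) (F F' : J -> V) :
  {in s, F =1 F'} -> average s F = average s F'.
Proof. by move=> FF'; rewrite /average; congr (_ *: _); exact: eq_big_seq. Qed.

Lemma average_cst (J : Type) (V : lmodType R[i]) (s : seq J) (v : V) :
  (0 < size s)%N -> average s (fun=> v) = v.
Proof.
move=> s0; rewrite /average big_const_seq count_predT iter_addr_0 -[v *+ _]scaler_nat scalerA.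
rewrite -[X in _ * X](rmorph_nat (real_complex R)) -rmorphM/= mulVf ?scale1r//.
by rewrite pnatr_eq0 -lt0n.
Qed.

Lemma average_map (J1 J : Type) (V : lmodType R[i]) (s : seq J1) (f : J1 -> J) (F : J -> V) :
  average (map f s) F = average s (F \o f).
Proof. by rewrite /average size_map big_map. Qed.

Lemma sum_cst_seq (J : Type) (s : seq J) (c : R) : \sum_(j <- s) c = (size s)%:R * c.
Proof. by rewrite big_const_seq count_predT iter_addr_0 -[c *+ _]mulr_natl. Qed.

Lemma ler_sum_mem (J : eqType) (s : seq J) (F : J -> R) i :
  (forall j, 0 <= F j) -> i \in s -> F i <= \sum_(j <- s) F j.
Proof. by move=> F0 si; rewrite (big_rem i)//= lerDl sumr_ge0. Qed.

Lemma sqrD_le4 (a b c : R) : a ^+ 2 <= c -> b ^+ 2 <= c -> (a + b) ^+ 2 <= 4 * c.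
Proof.
move=> ac bc; rewrite -subr_ge0.
rewrite [X in 0 <= X](_ : _ = 2 * (c - a ^+ 2) + 2 * (c - b ^+ 2) + (a - b) ^+ 2); last by ring.
apply: addr_ge0; last exact: sqr_ge0.
by apply: addr_ge0; rewrite mulr_ge0// subr_ge0.
Qed.

Lemma variance_real (J : Type) (s : seq J) (a : J -> R) :
  (0 < size s)%N -> let m := (size s)%:R^-1 * \sum_(j <- s) a j in
  \sum_(j <- s) (a j - m) ^+ 2 + \sum_(j <- s) m ^+ 2 = \sum_(j <- s) a j ^+ 2.
Proof.
move=> s0 m; have sn : (size s)%:R != 0 :> R by rewrite pnatr_eq0 -lt0n.
rewrite -big_split/= [LHS](_ : _ = \sum_(j <- s) (a j ^+ 2 - 2 * m * a j + 2 * m ^+ 2)).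
  rewrite !big_split/= sumrN -mulr_sumr big_const_seq count_predT iter_addr_0.
  have -> : \sum_(j <- s) a j = (size s)%:R * m by rewrite /m mulVKf.
  rewrite -[2 * m ^+ 2 *+ _]mulr_natl; ring.
by apply: eq_bigr => j _; ring.
Qed.

Lemma variance_complex (J : Type) (s : seq J) (a : J -> R[i]) :
  (0 < size s)%N -> let m := ((size s)%:R^-1)%:C * \sum_(j <- s) a j in
  \sum_(j <- s) sqmod (a j - m) + \sum_(j <- s) sqmod m = \sum_(j <- s) sqmod (a j).
Proof.
move=> s0 m.
have ReS : complex.Re (\sum_(j <- s) a j) = \sum_(j <- s) complex.Re (a j).
  by elim/big_rec2: _ => // j _ z _ <-; case: (a j) z => ? ? [].
have ImS : complex.Im (\sum_(j <- s) a j) = \sum_(j <- s) complex.Im (a j).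
  by elim/big_rec2: _ => // j _ z _ <-; case: (a j) z => ? ? [].
have ReB (z w : R[i]) : complex.Re (z - w) = complex.Re z - complex.Re w by case: z w => ? ? [].
have ImB (z w : R[i]) : complex.Im (z - w) = complex.Im z - complex.Im w by case: z w => ? ? [].
have Rem : complex.Re m = (size s)%:R^-1 * \sum_(j <- s) complex.Re (a j).
  rewrite /m -ReS; case: (\sum_(j <- s) a j) => u v /=; by rewrite mul0r subr0.
have Imm : complex.Im m = (size s)%:R^-1 * \sum_(j <- s) complex.Im (a j).
  rewrite /m -ImS; case: (\sum_(j <- s) a j) => u v /=; by rewrite mul0r addr0.
rewrite /sqmod !big_split/=.
under eq_bigr do rewrite ReB.
under [X in _ + X + _]eq_bigr do rewrite ImB.
rewrite addrACA Rem Imm.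
by rewrite !variance_real.
Qed.

Lemma ell2norm_sum_sqr (I : choiceType) (J : choiceType) (s : seq J) (F : J -> ell2 R I) :
  (\sum_(j <- s) ell2norm (F j) ^+ 2)%:E =
  \esum_(i in [set: I]) (\sum_(j <- s) sqmod (val (F j) i))%:E.
Proof.
rewrite -sumEFin; under eq_bigr do rewrite ell2norm_sqr.
by rewrite -esum_sum => [|i j _ _]; rewrite ?sqmod_lee_ge0//; apply: eq_esum => i _; rewrite sumEFin.
Qed.

(** The total squared length of a family splits into its spread around the mean and
    the length of the mean, coordinatewise. *)
Lemma variance (I : choiceType) (J : choiceType) (s : seq J) (F : J -> ell2 R I) :
  (0 < size s)%N ->
  \sum_(j <- s) ell2norm (F j - average s F) ^+ 2 +
  \sum_(j <- s) ell2norm (average s F) ^+ 2 = \sum_(j <- s) ell2norm (F j) ^+ 2.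
Proof.
move=> s0; apply: EFin_inj; rewrite EFinD !ell2norm_sum_sqr -esumD; last 2 first.
- by move=> i _; rewrite lee_fin sumr_ge0// => j _; exact: sqmod_ge0.
- by move=> i _; rewrite lee_fin sumr_ge0// => j _; exact: sqmod_ge0.
apply: eq_esum => i _; rewrite -EFinD -(variance_complex (fun j => val (F j) i) s0).
by under eq_bigr do rewrite ell2DE ell2NE average_coord; rewrite average_coord.
Qed.

End Averages.

Section LeftRegular.
Variables (R : realType) (G : groupType).
Local Notation H := (ell2 R G).
Local Notation lambda := (@leftreg R G).

Lemma leftregE g x h : val (lambda g x) h = val x (g^-1 * h)%g.
Proof. by []. Qed.

Lemma leftreg_norm g x : ell2norm (lambda g x) = ell2norm x.
Proof.
rewrite /ell2norm /sqsum; congr (Num.sqrt (fine _)).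
rewrite (@reindex_esum _ _ _ setT setT (fun h => g * h)%g)//.
  by apply: eq_esum => i _; rewrite leftregE mulKg.
split=> // [h k _ _ /(congr1 (fun z => g^-1 * z)%g)|h _]; first by rewrite !mulKg.
by exists (g^-1 * h)%g => //; rewrite mulVKg.
Qed.

Lemma opbound_leftreg g : opbound (lambda g) 1.
Proof. by move=> x; rewrite leftreg_norm mul1r. Qed.

Lemma leftregM g h x : lambda g (lambda h x) = lambda (g * h)%g x.
Proof. by apply: val_inj; apply/funext => k; rewrite !leftregE invgM mulgA. Qed.

Lemma leftreg1 x : lambda 1%g x = x.
Proof. by apply: val_inj; apply/funext => k; rewrite !leftregE invg1 mul1g. Qed.

Lemma leftreg_linear g : linear (lambda g).
Proof.
move=> a x y; apply: val_inj; apply/funext => k.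
by rewrite ell2DE ell2ZE !leftregE ell2DE ell2ZE.
Qed.

Lemma leftreg_average (J : Type) (s : seq J) (F : J -> H) g :
  lambda g (average s F) = average s (fun j => lambda g (F j)).
Proof.
apply: val_inj; apply/funext => k.
by rewrite leftregE !average_coord; congr (_ * _); apply: eq_bigr => j _.
Qed.

End LeftRegular.

(** The operator that averaging by conjugation makes out of [leftreg f]. *)
Definition conj_average (R : realType) (G : groupType) (s : seq G) (f : G) :
    ell2 R G -> ell2 R G :=
  average s (fun g => leftreg (g * f * g^-1)%g).
Arguments conj_average R {G} s f.

(** * Amenability and the norm of averages of translations *)

Section Kesten.
Variables (R : realType) (K : groupType).
Local Notation H := (ell2 R K).
Local Notation lambda := (@leftreg R K).

(** If the mean of the translates of [x] is almost as long as [x], the variance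
    formula forces all translates to be close to their mean, hence to [x] itself,
    as the identity is put among the translating elements. *)
Lemma almost_invariant_vector :
  (forall s c, s != [::] -> 0 <= c -> c < 1 -> ~ opbound (average s lambda) c) ->
  forall (F : seq K) d, 0 < d ->
  exists2 x : H, 0 < ell2norm x &
    forall g, g \in F -> ell2norm (lambda g x - x) ^+ 2 <= d * ell2norm x ^+ 2.
Proof.
move=> nogap F d d0; pose s := 1%g :: F; pose n : R := (size s)%:R.
have n0 : 0 < n by rewrite /n/= ltr0n.
have D0 : 0 < 8 * n + d by rewrite addr_gt0// mulr_gt0.
(* The mean is longer than $1-b$; [b] is chosen below $1$ with $8nb \le d$,
   where $8nb$ is the defect produced by the two uses of [dist]. *)
pose b := d / (8 * n + d); have b0 : 0 < b by rewrite divr_gt0.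
have b1 : b <= 1 by rewrite ler_pdivrMr// mul1r lerDr mulr_ge0 ?ltW.
have bd : 8 * n * b <= d.
  by rewrite /b mulrA ler_pdivrMr// mulrC ler_pM2l// lerDl ltW.
clearbody b.
have /existsNP[x /negP] : ~ opbound (average s lambda) (1 - b).
  by apply: nogap => //; rewrite ?subr_ge0// ltrBlDr ltrDl.
rewrite -ltNge averageE => xm; set m := average s _ in xm.
have x0 : 0 < ell2norm x.
  rewrite lt_def ell2norm_ge0 andbT; apply/eqP => /eqP x0.
  have {}x0 : x = 0 by apply: ell2norm_eq0; rewrite (eqP x0).
  move: xm; suff -> : m = 0 by rewrite x0 ell2norm0 mulr0 ltxx.
  by apply: val_inj; apply/funext => k; rewrite /m average_coord big1 ?mulr0// => g _; rewrite leftregE x0.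
exists x => // g gF.
have := variance (fun g => lambda g x) (isT : 0 < size s)%N; rewrite -/m.
under [in RHS]eq_bigr do rewrite leftreg_norm.
rewrite !sum_cst_seq -/n => V.
have dist h : h \in s -> ell2norm (lambda h x - m) ^+ 2 <= 2 * n * b * ell2norm x ^+ 2.
  move=> hs; apply: (@le_trans _ _ (n * (ell2norm x ^+ 2 - ell2norm m ^+ 2))).
    rewrite mulrBr -V addrK.
    by apply: (ler_sum_mem (F := fun j => ell2norm (lambda j x - m) ^+ 2)) => // j; exact: sqr_ge0.
  rewrite [2 * n]mulrC -!mulrA ler_pM2l// lerBlDr -lerBlDl.
  have : ((1 - b) * ell2norm x) ^+ 2 <= ell2norm m ^+ 2.
    by rewrite ler_sqr ?nnegrE ?mulr_ge0 ?subr_ge0 ?ell2norm_ge0// ltW.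
  apply: le_trans; rewrite exprMn -subr_ge0.
  rewrite [X in 0 <= X](_ : _ = b ^+ 2 * ell2norm x ^+ 2); last by ring.
  by rewrite mulr_ge0 ?sqr_ge0.
have dg := dist g (mem_behead (s := s) gF).
(* The identity belongs to the averaging set, so [x] is one of the translates. *)
have d1 := dist 1%g (mem_head _ _); rewrite leftreg1 in d1.
have tri : ell2norm (lambda g x - x) <= ell2norm (lambda g x - m) + ell2norm (x - m).
  by rewrite -(ell2normN (x - m)) opprB; apply: le_trans (ell2normD _ _); rewrite addrA subrK.
apply: (@le_trans _ _ (8 * n * b * ell2norm x ^+ 2)); last by rewrite ler_wpM2r ?sqr_ge0.
apply: (@le_trans _ _ ((ell2norm (lambda g x - m) + ell2norm (x - m)) ^+ 2)).
  by rewrite ler_sqr ?nnegrE ?addr_ge0 ?ell2norm_ge0.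
rewrite (_ : 8 * n * b * _ = 4 * (2 * n * b * ell2norm x ^+ 2)); last by ring.
exact: sqrD_le4.
Qed.

(** A finitely additive probability measure invariant up to [e] under the elements
    of [F]; one inequality suffices, since the other is the one for the inverse. *)
Definition almost_mean (F : seq K) (e : R) (p : set K -> R) : Prop :=
  [/\ forall A, 0 <= p A,
      p setT = 1,
      forall A B, A `&` B = set0 -> p (A `|` B) = p A + p B
    & forall g A, g \in F -> p [set (g * x)%g | x in A] <= p A + e].

Lemma sqsum_on_fin (A : set K) (x : H) : sqsum_on A (val x) \is a fin_num.
Proof.
have := valP x => /asboolP xf; rewrite ge0_fin_numE ?sqsum_on_ge0//.
apply: le_lt_trans xf; rewrite /sqsum_on esum_mkcond; apply: le_esum => i _.
by case: ifP => // _; exact: sqmod_lee_ge0.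
Qed.

(** The square of the modulus of an almost invariant vector is the density of an
    almost invariant measure. *)
Lemma almost_mean_exists :
  (forall s c, s != [::] -> 0 <= c -> c < 1 -> ~ opbound (average s lambda) c) ->
  forall (F : seq K) e, 0 < e -> exists p, almost_mean F e p.
Proof.
move=> nogap F e e0.
(* With weight [t] and defect [d], the two error terms of [sqsum_on_split]
   contribute $e/2$ each. *)
pose t := e / 2; have t0 : 0 < t by rewrite divr_gt0.
have u0 : 0 < 1 + 1 / t by rewrite addr_gt0// divr_gt0.
pose d := t / (1 + 1 / t); have d0 : 0 < d by rewrite divr_gt0.
have [x x0 xF] := almost_invariant_vector nogap [seq g^-1%g | g <- F] d0.
have X0 : 0 < ell2norm x ^+ 2 by rewrite exprn_gt0.
have XE : ell2norm x ^+ 2 = fine (sqsum_on setT (val x)).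
  by apply: EFin_inj; rewrite ell2norm_sqr fineK// sqsum_on_fin.
exists (fun A => fine (sqsum_on A (val x)) / ell2norm x ^+ 2); split.
- by move=> A; rewrite divr_ge0 ?fine_ge0 ?sqsum_on_ge0// ltW.
- by rewrite -XE divff// gt_eqF.
- move=> A B AB; rewrite -mulrDl; congr (_ / _).
  rewrite -fineD ?sqsum_on_fin//; congr fine.
  rewrite /sqsum_on (esumID A) => [|i _]; last exact: sqmod_lee_ge0.
  rewrite setIUl setIid [B `&` A]setIC AB setU0; congr (_ + \esum_(i in _) _)%E.
  rewrite setIUl setICr set0U; apply/seteqP; split=> [i []//|i Bi]; split=> // Ai.
  by have : (A `&` B) i by []; rewrite AB.
move=> g A gF; rewrite ler_pdivrMr// mulrDl divfK ?gt_eqF//.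
rewrite -lee_fin fineK ?sqsum_on_fin//.
have -> : sqsum_on [set (g * h)%g | h in A] (val x) = sqsum_on A (val (lambda g^-1%g x)).
  rewrite /sqsum_on esum_image => [|h k _ _ /mulgI//].
  by apply: eq_esum => h _; rewrite leftregE invgK.
have -> : val (lambda g^-1%g x) = (fun h => val x h + val (lambda g^-1%g x - x) h)%R.
  by apply/funext => h; rewrite ell2DE ell2NE addrC subrK.
apply: (le_trans (sqsum_on_split _ _ _ ltr01 t0)).
rewrite -[sqsum_on A (val x)]fineK ?sqsum_on_fin// -[X in (_ + _ * X)%E]fineK ?sqsum_on_fin//.
rewrite -!EFinM -EFinD lee_fin mulrDl mul1r -addrA lerD2l divr1.
have mon (y : H) : fine (sqsum_on A (val y)) <= ell2norm y ^+ 2.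
  rewrite -lee_fin fineK ?sqsum_on_fin// ell2norm_sqr /sqsum_on esum_mkcond.
  by apply: le_esum => i _; case: ifP => // _; exact: sqmod_lee_ge0.
rewrite [e]splitr [leRHS]mulrDl; apply: lerD; first by rewrite ler_wpM2l// ltW.
apply: (@le_trans _ _ ((1 + 1 / t) * (d * ell2norm x ^+ 2))).
  rewrite ler_pM2l//; apply: (le_trans (mon _)); apply: xF.
  by apply/mapP; exists g.
by rewrite mulrA [_ * d]mulrC divfK ?gt_eqF//.
Qed.

(** An ultrafilter refining the tails of the directed set of pairs (finite set,
    precision) turns almost invariant measures into an invariant one: the masses
    lie in the compact interval [0, 1]. *)
Lemma amenable_of_almost_means :
  (forall (F : seq K) e, 0 < e -> exists p, almost_mean F e p) -> amenable R K.
Proof.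
move=> am.
have /choice[p pP] : forall j : seq K * nat, exists p, almost_mean j.1 (j.2.+1%:R^-1) p.
  by move=> [F n]; apply: am; rewrite invr_gt0.
pose tails : set_system (seq K * nat) :=
  [set B | exists j : seq K * nat, forall j' : seq K * nat,
  {subset j.1 <= j'.1} -> (j.2 <= j'.2)%N -> B j'].
have tailsP : ProperFilter tails.
  split; first by move=> [j /(_ j)]; apply.
  split; first by exists ([::], 0%N).
  - move=> B C [j jB] [k kC]; exists (j.1 ++ k.1, maxn j.2 k.2) => l /= lF.
    rewrite geq_max => /andP[jl kl]; split; [apply: jB => // | apply: kC => //].
      by move=> g gj; apply: lF; rewrite mem_cat gj.
    by move=> g gk; apply: lF; rewrite mem_cat gk orbT.
  - by move=> B C BC [j jB]; exists j => l lF jl; apply: BC; exact: jB.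
have [W [WU tW]] := ultraFilterLemma tailsP.
have limP A : exists l : R, p ^~ A @ W --> l.
  have : UltraFilter (p ^~ A @ W).
    split=> [|S SP WS]; first exact: fmap_proper_filter.
    apply/seteqP; split => [B SB|]; last exact: WS.
    have [//|WnB] := in_ultra_setVsetC ((p ^~ A) @^-1` B) WU.
    exfalso; have SnB : S (~` B) by apply: WS.
    by apply: (@filter_not_empty _ S SP); rewrite -(setICr B); exact: filterI.
  have := @segment_compact R 0 1; rewrite compact_ultra => cpt WAU.
  have [|l [_ lP]] := cpt _ WAU; last by exists l.
  apply: (@filterE _ W) => j /=; have [p0 p1 pD _] := pP j; rewrite in_itv/= p0/=.
  by rewrite -p1 -(setvU A) setUC pD ?setICr// lerDl.
have [mu muP] := choice limP.
exists mu; split.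
- move=> A; apply: (cvgr_to_ge (muP A)); apply: filterE => j.
  by have [p0 _ _ _] := pP j.
- apply: (@cvg_unique _ (@norm_hausdorff R R^o) _ _ _ _ (muP setT)).
  rewrite (_ : p ^~ setT = fun=> 1); first exact: cvg_cst.
  by apply/funext => j; have [_ ->] := pP j.
- move=> A B AB; apply: (@cvg_unique _ (@norm_hausdorff R R^o) _ _ _ _ (muP _)).
  rewrite (_ : p ^~ (A `|` B) = p ^~ A \+ p ^~ B); first exact: cvgD.
  by apply/funext => j; have [_ _ ->] := pP j.
have le_mu g A : mu [set (g * x)%g | x in A] <= mu A.
  apply/ler_addgt0Pr => e e0.
  rewrite -subr_ge0.
  have lim : (fun j => p j A + e - p j [set (g * x)%g | x in A]) @ W -->
      mu A + e - mu [set (g * x)%g | x in A].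
    by apply: cvgB => //; apply: cvgD => //; exact: cvg_cst.
  apply: (cvgr_to_ge lim); apply: tW.
  have [n ne] : exists n : nat, n.+1%:R^-1 <= e.
    exists (Num.bound (e^-1 : R)); rewrite -[leRHS]invrK lef_pV2 ?posrE ?invr_gt0//.
    apply: ltW; apply: (lt_trans (archi_boundP _)); first by rewrite invr_ge0 ltW.
    by rewrite ltr_nat.
  exists ([:: g], n) => -[F m] /= gF nm; have [_ _ _ /(_ g A) pg] := pP (F, m).
  rewrite subr_ge0; apply: (le_trans (pg _)); first by apply: gF; rewrite inE.
  rewrite lerD2l; apply: le_trans ne.
  by rewrite lef_pV2 ?posrE// ler_nat ltnS.
move=> g A; apply/eqP; rewrite eq_le le_mu/=.
have := le_mu g^-1%g [set (g * x)%g | x in A]; rewrite image_comp.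
rewrite (_ : (fun x => (g^-1 * x)%g) \o _ = idfun) ?image_id//.
by apply/funext => x /=; rewrite mulKg.
Qed.

(** The $n$-th convolution power of an average acts as the $n$-th power of its
    operator. *)
Lemma average_opbound_pow (s : seq K) c n : s != [::] -> 0 <= c -> opbound (average s lambda) c ->
  exists2 t : seq K, t != [::] & opbound (average t lambda) (c ^+ n).
Proof.
move=> s0 c0 sc; elim: n => [|n [t t0 tc]].
  exists [:: 1%g] => //; apply: opbound_average => // g _; exact: opbound_leftreg.
exists [seq (g * h)%g | g <- s, h <- t].
  by rewrite -size_eq0 size_allpairs muln_eq0 !size_eq0 negb_or s0.
rewrite exprS => x; apply: le_trans (opbound_comp c0 sc tc x).
rewrite average_allpairs !averageE /= averageE le_eqVlt; apply/orP; left; apply/eqP.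
congr ell2norm; apply: eq_average => g _.
rewrite !averageE leftreg_average; apply: eq_average => h _ /=.
by rewrite leftregM.
Qed.

(** The hard half of Kesten's criterion. Were every average of norm $1$, there
    would be almost invariant vectors and so an invariant mean; and as soon as one
    average has norm less than $1$, its powers have arbitrarily small norm. *)
Theorem kesten : ~ amenable R K -> forall e, 0 < e ->
  exists2 s : seq K, s != [::] & opbound (average s lambda) e.
Proof.
move=> namen e e0.
have [s [c [s0 c0 c1 sc]]] : exists s c,
    [/\ s != [::], 0 <= c, c < 1 & opbound (average s lambda) c].
  apply: contra_notP namen => nogap; apply: amenable_of_almost_means.
  apply: almost_mean_exists => s c s0 c0 c1 sc; apply: nogap.
  by exists s, c.
have [n cn] : exists n, c ^+ n <= e.
  have := @cvg_expr R c; rewrite ger0_norm// => /(_ c1) /cvgrPdist_le /(_ e e0) [n _ /(_ n)].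
  by move=> /(_ (leqnn n)) /=; rewrite sub0r normrN ger0_norm ?exprn_ge0//; exists n.
have [t t0 tc] := average_opbound_pow n s0 c0 sc.
by exists t => //; exact: opboundW tc.
Qed.

End Kesten.

(** * Transferring norm bounds along equivariant maps *)

Section Fold.
Variables (R : realType) (G K : groupType) (kappa : G -> K) (u : K -> G).
Hypothesis kappaE : forall k h, kappa (u k * h)%g = (k * kappa h)%g.

Let fibre (k : K) : set G := [set h | kappa h = k].

Lemma sqsum_fibres (f : G -> R[i]) : sqsum f = \esum_(k in [set: K]) sqsum_on (fibre k) f.
Proof.
rewrite /sqsum_on esum_esum => [|k h _ _]; last exact: sqmod_lee_ge0.
rewrite (@reindex_esum _ _ _ setT _ (fun h => (kappa h, h)))//.
split=> [h _ //|h h' _ _ [] //|[k h] /= [_ hk]]; exists h => //.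
by rewrite -[in RHS]hk.
Qed.

Lemma sqsum_on_translate (f : G -> R[i]) g k :
  sqsum_on (fibre k) (fun h => f ((u g)^-1 * h)%g) = sqsum_on (fibre (g^-1 * k)%g) f.
Proof.
rewrite /sqsum_on (@reindex_esum _ _ _ (fibre (g^-1 * k)%g) _ (fun h => u g * h)%g).
  by apply: eq_esum => h _; rewrite mulKg.
split=> [h hk|h h' _ _ /mulgI//|h hk]; first by rewrite /fibre/= kappaE hk mulVKg.
by exists ((u g)^-1 * h)%g; rewrite ?mulVKg// /fibre/= -hk -[in RHS](mulVKg (u g) h) kappaE mulKg.
Qed.

(** The coefficients of an average are nonnegative, so replacing a vector by its
    $\ell^2$ norms along the fibres of [kappa] keeps its norm and can, by
    Minkowski's inequality, only increase pointwise the fibre norms of its image.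
    This is how an average of permutation operators which are merely compatible
    with the translations of [K] inherits the bound known on [ell2 R K]; the map
    [u] does not have to be a homomorphism. *)
Theorem opbound_average_fold (s : seq K) (c : R) : 0 <= c ->
  opbound (average s (@leftreg R K)) c -> opbound (average s (fun k => @leftreg R G (u k))) c.
Proof.
move=> c0 sc x.
pose X2 k := sqsum_on (fibre k) (val x).
have X2fin k : X2 k \is a fin_num by exact: sqsum_on_fin.
pose xi k : R := Num.sqrt (fine (X2 k)).
have xi0 k : 0 <= xi k by exact: sqrtr_ge0.
have xiE k : (xi k ^+ 2)%:E = X2 k.
  by rewrite sqr_sqrtr ?fine_ge0 ?sqsum_on_ge0// fineK.
have Xsum : sqsum (fun k => (xi k)%:C) = sqsum (val x).
  by rewrite sqsum_fibres; apply: eq_esum => k _; rewrite sqmod_real xiE.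
have XP : (fun k => (xi k)%:C) \in @sqsummable R K.
  by apply/asboolP; rewrite Xsum; have /asboolP := valP x.
pose X : ell2 R K := exist _ (fun k => (xi k)%:C) XP.
have Xnorm : ell2norm X = ell2norm x by rewrite /ell2norm -Xsum.
apply: le_trans (_ : ell2norm (average s (@leftreg R K) X) <= _); last by rewrite -Xnorm.
rewrite ell2norm_le ?ell2norm_ge0// ell2norm_sqr sqsum_fibres.
apply: le_esum => k _; rewrite !averageE average_coord.
rewrite (_ : _ * _ = (\sum_(g <- s) (size s)%:R^-1 * xi (g^-1 * k)%g)%:C); last first.
  by rewrite rmorph_sum mulr_sumr; apply: eq_bigr => g _; rewrite rmorphM.
rewrite sqmod_real.
rewrite (_ : val _ = (fun h => \sum_(g <- s) ((size s)%:R^-1)%:C * val x ((u g)^-1 * h)%g)%R).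
  apply: sqsum_on_sum_le => g; first by rewrite mulr_ge0 ?invr_ge0.
  apply: (le_trans (sqsum_onZ _ _ _)).
  by rewrite sqsum_on_translate sqmod_real -/(X2 _) -xiE -EFinM exprMn.
by apply/funext => h; rewrite average_coord mulr_sumr.
Qed.

End Fold.

Section EquivariantCoordinate.
Variables (G K : groupType) (j : K -> G) (L : set G).
Hypothesis jM : {morph j : a b / (a * b)%g}.
Hypothesis L1 : L 1%g.
Hypothesis LM : forall a b, L a -> L b -> L (a * b)%g.
Hypothesis LV : forall a, L a -> L a^-1%g.
Hypothesis jL : forall a l, L l -> (j a * l = l * j a)%g.
Hypothesis jL1 : forall a, L (j a) -> a = 1%g.

(** [G] is a union of right cosets of the internal direct product $j(K) \times L$;
    after a representative is chosen in each of them, [kappa h] is the component in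
    $K$ of the quotient of [h] by its representative. *)
Lemma equivariant_coordinate :
  exists kappa : G -> K, forall k l h, L l -> kappa (j k * l * h)%g = (k * kappa h)%g.
Proof.
have j1 : j 1%g = 1%g by apply: (@mulgI _ (j 1%g)); rewrite -jM !mulg1.
have jV a : j a^-1%g = (j a)^-1%g.
  by apply: (@mulgI _ (j a)); rewrite -jM !mulgV j1.
pose E h h' := exists a l, L l /\ h = (j a * l * h')%g.
pose r h := xget 1%g [set h' | E h h'].
have Er h : E h (r h).
  apply: (@xgetPex _ 1%g [set h' | E h h']).
  by exists h; exists 1%g, 1%g; rewrite j1 !mul1g.
(* The representative depends on the coset only: both sides choose in equal sets. *)
have rE k l h : L l -> r (j k * l * h)%g = r h.
  move=> Ll; rewrite /r; congr (xget _ _); apply/seteqP; split=> h' [a [l' [Ll' hE]]].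
    exists (k^-1 * a)%g, (l^-1 * l')%g; split; first exact/LM/Ll'/LV.
    apply: (@mulgI _ (j k * l)%g); rewrite hE !mulgA -(mulgA (j k) l) -(jL _ Ll).
    by rewrite !mulgA -jM mulVKg mulgK.
  exists (k * a)%g, (l * l')%g; split; first exact: LM.
  by rewrite hE jM !mulgA -[(j k * l * j a)%g]mulgA -(jL a Ll) !mulgA.
have /choice[kappa kappaP] : forall h, exists a, exists l, L l /\ h = (j a * l * r h)%g by [].
exists kappa => k l h Ll.
have [l' [Ll' hE]] := kappaP h.
have [l2 [Ll2]] := kappaP (j k * l * h)%g; rewrite rE// => eq2.
have eq1 : (j k * l * h)%g = (j (k * kappa h) * (l * l') * r h)%g.
  by rewrite {1}hE jM !mulgA -[(j k * l * j _)%g]mulgA -(jL _ Ll) !mulgA.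
have /mulIg eq3 := etrans (esym eq2) eq1.
suff /jL1 /(congr1 (fun z => (k * kappa h) * z)%g) : L (j ((k * kappa h)^-1 * kappa (j k * l * h))%g).
  by rewrite mulVKg mulg1.
rewrite jM jV (_ : (_ * _)%g = l * l' * l2^-1)%g; first by apply: LM; [exact: LM|exact: LV].
apply: (@mulIg _ l2); rewrite mulgVK -mulgA eq3 mulgA mulVg mul1g //.
Qed.

End EquivariantCoordinate.

(** * Displaced open sets and rigid stabilizers *)

Section Action.
Variables (X : topologicalType) (G : groupClosed (homeo X)).
Local Notation gT := (subgroup G).
Implicit Types (g f : gT) (U : set X).

Definition act g : X -> X := homeo_fun (val g).

Lemma actM f g x : act (f * g)%g x = act f (act g x).
Proof. by []. Qed.

Lemma act1 x : act 1%g x = x.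
Proof. by []. Qed.

Lemma actK g : cancel (act g) (act g^-1%g).
Proof. by move=> x; rewrite -actM mulVg. Qed.

Lemma actVK g : cancel (act g^-1%g) (act g).
Proof. by move=> x; rewrite -actM mulgV. Qed.

Lemma act_inj g : injective (act g).
Proof. exact: can_inj (actK g). Qed.

Lemma act_ext f g : act f =1 act g -> f = g.
Proof. by move=> fg; apply: val_inj; exact: homeo_ext. Qed.

Lemma act_continuous g : continuous (act g).
Proof. exact: homeo_fun_continuous. Qed.

Definition fixes U g : Prop := forall x, U x -> act g x = x.

Definition displaces U g : Prop := forall x, U x -> ~ U (act g x).

Lemma fixesM U f g : fixes U f -> fixes U g -> fixes U (f * g)%g.
Proof. by move=> fU gU x Ux; rewrite actM gU// fU. Qed.

Lemma fixesV U g : fixes U g -> fixes U g^-1%g.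
Proof. by move=> gU x Ux; rewrite -[in LHS](gU _ Ux) actK. Qed.

Lemma fixes_compl U g x : fixes (~` U) g -> U x -> U (act g x).
Proof.
move=> gU Ux; apply: contrapT => nU.
by have := gU _ nU => /act_inj gx; apply: nU; rewrite gx.
Qed.

(** Homeomorphisms with disjoint supports commute. *)
Lemma fixes_commute U f g : fixes U f -> fixes (~` U) g -> (g * f = f * g)%g.
Proof.
move=> fU gU; apply: act_ext => x; rewrite !actM.
have [Ux|nUx] := pselect (U x).
  by rewrite (fU _ Ux) fU//; exact: fixes_compl.
rewrite (gU _ nUx) gU//; apply: (@fixes_compl (~` U)) => //.
by rewrite setCK.
Qed.

Lemma fixes_compl_eq1 U g : fixes U g -> fixes (~` U) g -> g = 1%g.
Proof.
move=> gU gU'; apply: act_ext => x; rewrite act1.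
by have [|] := pselect (U x); [exact: gU|exact: gU'].
Qed.

Section RistEmbedding.
Variable U : set X.

Lemma rist_sub (k : subgroup (rist G U)) : val k \in G.
Proof. by have /andP[] := valP k. Qed.

Definition rist_embed (k : subgroup (rist G U)) : gT := exist _ (val k) (rist_sub k).

Lemma rist_embedM : {morph rist_embed : a b / (a * b)%g}.
Proof. by move=> a b; apply: val_inj. Qed.

Lemma rist_embed_fixes k : fixes (~` U) (rist_embed k).
Proof. by move=> x Ux; have /andP[_ /asboolP] := valP k; apply. Qed.

Lemma rist_embed_eq1 k : rist_embed k = 1%g -> k = 1%g.
Proof. by move=> /(congr1 val) k1; apply: val_inj. Qed.

End RistEmbedding.

(** Conjugating by [f] moves the support off [U]. *)
Lemma displaced_conj_fixes U f g : displaces U f -> fixes (~` U) g ->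
  fixes U (f * g * f^-1)%g.
Proof.
move=> fU gU x Ux; rewrite !actM gU ?actVK// => Ufx.
by apply: (fU _ Ufx); rewrite actVK.
Qed.

Lemma displaced_open_subset U f x : hausdorff_space X -> open U -> U x ->
  act f x <> x -> exists V, [/\ open V, V !=set0, V `<=` U & displaces V f].
Proof.
move=> hX oU Ux /eqP fx; move: hX; rewrite open_hausdorff => /(_ _ _ fx).
move=> [[A B] /= [fA xB] [oA oB /eqP AB]].
rewrite !inE in fA xB.
exists (U `&` B `&` act f @^-1` A); split.
- apply: openI; first exact: openI.
  by apply: open_comp => // y _; exact: act_continuous.
- by exists x.
- by move=> y [[]].
- move=> y [_ Afy] [[_ Bfy] _].
  by have : (A `&` B) (act f y) by []; rewrite AB.
Qed.

(** Wherever [f] is not locally trivial it displaces a smaller open set, and both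
    alternatives pass to smaller open sets; so finitely many elements can be
    treated one after the other. *)
Lemma displaces_or_fixes (L : seq gT) U : hausdorff_space X -> open U -> U !=set0 ->
  exists V, [/\ open V, V !=set0, V `<=` U
    & forall f, f \in L -> fixes V f \/ displaces V f].
Proof.
move=> hX; elim: L U => [|f L IH] U oU U0; first by exists U; split.
suff [W [oW W0 WU Wf]] : exists W, [/\ open W, W !=set0, W `<=` U & fixes W f \/ displaces W f].
  have [V [oV V0 VW VL]] := IH W oW W0; exists V; split=> //; first exact: subset_trans WU.
  move=> g; rewrite inE => /predU1P[->|/VL//].
  case: Wf => Wf; [left=> x /VW; exact: Wf|right=> x Vx Vfx].
  by apply: (Wf x); exact: VW.
have [fU|/existsNP[x /not_implyP[Ux fx]]] := pselect (fixes U f).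
  by exists U; split=> //; left.
by have [V [oV V0 VU Vf]] := displaced_open_subset hX oU Ux fx; exists V; split=> //; right.
Qed.

End Action.

(** * Averaging conjugates *)

Section PowersAveraging.
Variables (R : realType) (X : topologicalType) (G : groupClosed (homeo X)).
Local Notation gT := (subgroup G).
Local Notation lambda := (@leftreg R gT).

(** For $g \in G_U$ and $f$ displacing $U$, one has
    $g f g^{-1} = g \, (f g^{-1} f^{-1}) \, f$, where the middle factor acts
    trivially on $U$. A coordinate on the group with values in $G_U$, blind to the
    elements acting trivially on $U$, thus reduces the average of the conjugates
    to an average over $G_U$ on its own $\ell^2$ space, where Kesten's criterion
    makes it small. One average serves all the displacing elements at once. *)
Lemma rist_average (U : set X) e : ~ amenable R (subgroup (rist G U)) -> 0 < e ->
  exists s : seq gT, [/\ s != [::], forall g, g \in s -> fixes (~` U) g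
    & forall f, displaces U f -> opbound (conj_average R s f) e].
Proof.
move=> namen e0; have [s s0 sb] := kesten namen e0.
exists [seq rist_embed k | k <- s]; split.
- by case: s s0 {sb}.
- by move=> _ /mapP[k _ ->]; exact: rist_embed_fixes.
move=> f fU; pose j := @rist_embed X G U.
have [kappa kappaE] : exists kappa : gT -> subgroup (rist G U),
    forall k l h, fixes U l -> kappa (j k * l * h)%g = (k * kappa h)%g.
  apply: equivariant_coordinate.
  - exact: rist_embedM.
  - by [].
  - exact: fixesM.
  - exact: fixesV.
  - by move=> k l lU; exact: (fixes_commute lU (@rist_embed_fixes _ _ _ k)).
  - by move=> k kU; apply: rist_embed_eq1; exact: (fixes_compl_eq1 kU (@rist_embed_fixes _ _ _ k)).
pose u k := (j k * (f * (j k)^-1 * f^-1))%g.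
have uE k h : kappa (u k * h)%g = (k * kappa h)%g.
  apply: kappaE; apply: displaced_conj_fixes => //; apply: fixesV; exact: rist_embed_fixes.
have ub := opbound_average_fold uE (ltW e0) sb.
move=> x; rewrite -(leftreg_norm f x); apply: le_trans (ub _).
rewrite /conj_average average_map !averageE le_eqVlt; apply/orP; left; apply/eqP.
congr ell2norm; apply: eq_average => k _ /=.
by rewrite leftregM /u !mulgA mulgVK.
Qed.

(** Powers' averaging property, by induction on the number of elements. One takes
    [V] displaced by the first element and such that each of the others either
    displaces [V] or acts trivially on it. Averaging over [G_V] makes the conjugates of
    the displacing elements small and leaves the trivially acting ones unchanged;
    the latter are fewer, and the average that the induction hypothesis gives for
    them is applied on top, which does not spoil the bounds already reached. *)
Theorem powers_averaging : hausdorff_space X ->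
  (forall U : set X, open U -> U !=set0 -> ~ amenable R (subgroup (rist G U))) ->
  forall (L : seq gT) e, 0 < e -> (forall f, f \in L -> f != 1%g) ->
  exists2 s : seq gT, s != [::] & forall f, f \in L -> opbound (conj_average R s f) e.
Proof.
move=> hX namen L e e0; have [n] := ubnP (size L).
elim: n L => // n IH [_ _|f0 L Ln L1]; first by exists [:: 1%g].
have [x fx] : exists x, act f0 x <> x.
  apply/existsNP => f0x; have /eqP := L1 f0 (mem_head _ _); apply.
  by apply: act_ext => x; rewrite f0x.
have [U [oU U0 _ Uf0]] := displaced_open_subset hX openT I fx.
have [V [oV V0 VU VL]] := displaces_or_fixes L hX oU U0.
have Vf0 : displaces V f0 by move=> y /VU Uy /VU; exact: Uf0.
have [s [s0 sV sD]] := rist_average (namen V oV V0) e0.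
pose L' := [seq f <- L | `[< fixes V f >]].
have [||t t0 tL'] := IH L'.
- by rewrite ltnS in Ln; apply: leq_ltn_trans Ln; rewrite size_filter count_size.
- by move=> f; rewrite mem_filter => /andP[_ fL]; apply: L1; rewrite inE fL orbT.
exists [seq (h * k)%g | h <- t, k <- s].
  by rewrite -size_eq0 size_allpairs muln_eq0 !size_eq0 negb_or t0.
move=> f fL.
have [fV|fV] : fixes V f \/ displaces V f.
  by move: fL; rewrite inE => /predU1P[->|/VL//]; right.
- have /tL' : f \in L'.
    rewrite mem_filter; apply/andP; split; first exact/asboolP.
    move: fL; rewrite inE => /predU1P[f_f0|//]; exfalso.
    by have [y Vy] := V0; apply: (Vf0 y Vy); rewrite -f_f0 fV.
  suff -> : conj_average R [seq (h * k)%g | h <- t, k <- s] f = conj_average R t f by [].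
  rewrite /conj_average average_allpairs; apply: eq_average => h _.
  rewrite -[RHS](average_cst (s := s)) ?lt0n ?size_eq0//.
  apply: eq_average => k ks; congr lambda.
  by rewrite invgM -!mulgA (mulgA k) (fixes_commute fV (sV k ks)) -!mulgA mulVKg.
- rewrite /conj_average average_allpairs; apply: opbound_average => // h _ y.
  have := sD f fV (lambda h^-1%g y); rewrite leftreg_norm; apply: le_trans.
  rewrite -[leRHS](leftreg_norm h) /conj_average !averageE leftreg_average.
  rewrite le_eqVlt; apply/orP; left; apply/eqP; congr ell2norm; apply: eq_average => k _.
  by rewrite /= !leftregM invgM !mulgA.
Qed.

End PowersAveraging.

(** * The reduced algebra and the canonical trace *)

Section OperatorAlgebra.
Variables (R : realType) (G : groupType).
Local Notation H := (ell2 R G).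
Local Notation lambda := (@leftreg R G).
Implicit Types (S T : H -> H) (s : seq G) (c : G -> R[i]).

Lemma operatorZE (a : R[i]) T x : (a *: T) x = a *: T x.
Proof. by []. Qed.

Lemma span_linear s c : linear (\sum_(g <- s) c g *: lambda g).
Proof.
move=> a x y; rewrite !fct_sumE scaler_sumr -big_split/=; apply: eq_bigr => g _.
by rewrite !operatorZE leftreg_linear scalerDr !scalerA [c g * a]mulrC.
Qed.

Lemma span_opbound s c : opbound (\sum_(g <- s) c g *: lambda g) (\sum_(g <- s) cmod (c g)).
Proof.
apply: opbound_sum => g _; rewrite -[X in opbound _ X]mulr1; apply: opboundZ; exact: opbound_leftreg.
Qed.

Lemma span_Cstar_red S : leftreg_span S -> Cstar_red S.
Proof.
move=> [s [c ->]]; split.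
  split; first exact: span_linear.
  apply: le_lt_trans (opbound_opnorm _ (span_opbound s c)) (ltry _).
  by apply: sumr_ge0 => g _; exact: cmod_ge0.
move=> e e0; exists (\sum_(g <- s) c g *: lambda g); first by exists s, c.
by rewrite subrr; apply: opbound_opnorm; [|apply: opbound0]; exact: ltW.
Qed.

Lemma leftreg_Cstar_red g : Cstar_red (lambda g).
Proof. by apply: span_Cstar_red; exists [:: g], (fun=> 1); rewrite big_seq1 scale1r. Qed.

Lemma id_Cstar_red : Cstar_red (idfun : H -> H).
Proof.
rewrite (_ : idfun = lambda 1%g); first exact: leftreg_Cstar_red.
by apply/funext => x; rewrite leftreg1.
Qed.

(** Without repetitions the coefficients can be read off the image of the unit
    vector at the identity. *)
Lemma span_uniq s c : exists s' c', uniq s' /\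
  \sum_(g <- s) c g *: lambda g = \sum_(g <- s') c' g *: lambda g.
Proof.
exists (undup s), (fun g => (count_mem g s)%:R * c g); split; first exact: undup_uniq.
rewrite -big_undup_iterop_count; apply: eq_bigr => g _.
by rewrite -scalerA scaler_nat.
Qed.

Lemma Cstar_red_approx T e : Cstar_red T -> 0 < e -> exists s c, uniq s /\
  opbound (T - \sum_(g <- s) c g *: lambda g) e.
Proof.
move=> [[Tlin _] Tapp] e0; have [_ [s0 [c0 ->]]] := Tapp e e0.
have [s [c [us ->]] Se] := span_uniq s0 c0.
exists s, c; split=> //; apply: opnorm_opbound => //; last exact: ltW.
move=> a x y.
have -> z : (T - \sum_(g <- s) c g *: lambda g) z = T z - (\sum_(g <- s) c g *: lambda g) z by [].
by rewrite Tlin span_linear scalerBr opprD addrACA.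
Qed.

Lemma delta_sqsummable : (fun h => (h == 1%g)%:R) \in @sqsummable R G.
Proof.
apply/asboolP; rewrite /sqsum (esumID [set 1%g]) => [|h _]; last exact: sqmod_lee_ge0.
rewrite setTI esum_set1 ?sqmod_lee_ge0// esum1 ?adde0 ?ltry// => h [_ /eqP h1].
by rewrite (negbTE h1) /sqmod/= expr0n addr0.
Qed.

Definition delta : H := exist _ (fun h : G => (h == 1%g)%:R) delta_sqsummable.

Lemma deltaE h : val delta h = (h == 1%g)%:R.
Proof. by []. Qed.

Lemma delta_norm : ell2norm delta <= 1.
Proof.
rewrite ell2norm_le// /sqsum (esumID [set 1%g]) => [|h _]; last exact: sqmod_lee_ge0.
rewrite setTI esum_set1 ?sqmod_lee_ge0// deltaE eqxx esum1 => [|h [_ /eqP h1]].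
  by rewrite adde0 lee_fin /sqmod/= expr0n addr0.
by rewrite deltaE (negbTE h1) /sqmod/= expr0n addr0.
Qed.

Lemma span_coord s c x h :
  val ((\sum_(g <- s) c g *: lambda g) x) h = \sum_(g <- s) c g * val x (g^-1 * h)%g.
Proof. by rewrite fct_sumE ell2_sumE; apply: eq_bigr => g _; rewrite ell2ZE. Qed.

Lemma span_delta s c h :
  val ((\sum_(g <- s) c g *: lambda g) delta) h = \sum_(g <- s | g == h) c g.
Proof.
rewrite span_coord [RHS]big_mkcond; apply: eq_bigr => g _.
have -> : val delta (g^-1 * h)%g = (g == h)%:R.
  by rewrite deltaE mulg_eq1 (inj_eq (@invg_inj G)).
by case: eqP => _; rewrite ?mulr1 ?mulr0.
Qed.

Lemma sum_sqmod_uniq (f : G -> R[i]) s : uniq s ->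
  ((\sum_(g <- s) sqmod (f g))%:E <= sqsum f)%E.
Proof.
move=> us; apply: esum_ge; exists [set` s]; first by split=> //; exact: finite_seq.
by rewrite -fsbig_seq// sumEFin.
Qed.

(** The unit vector at the identity is separating. If [T] kills it, the
    approximants $S = \sum_g c_g \lambda_g$ of [T] have small coefficients in
    $\ell^2$, so the coordinates of $S x$ are small by the inequality of
    arithmetic and geometric means, for every fixed $x$. *)
Lemma Cstar_red_delta_eq0 T : Cstar_red T -> T delta = 0 -> T = 0.
Proof.
move=> TA Td; apply/funext => x; apply: val_inj; apply/funext => h.
rewrite [RHS](_ : _ = 0)//; apply: sqmod_eq0; rewrite -cmod_sqr.
suff : cmod (val (T x) h) <= 0.
  by rewrite le_eqVlt ltNge cmod_ge0 orbF => /eqP ->; rewrite expr0n.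
apply/ler_addgt0Pr => e0 e0_gt0; rewrite add0r.
pose X := ell2norm x.
have X0 : 0 <= X by exact: ell2norm_ge0.
(* The final estimate is $eX + e(1+X^2)/2$, which is at most $e(1+X)^2$. *)
pose e := e0 / (1 + X) ^+ 2.
have e_gt0 : 0 < e by rewrite divr_gt0// exprn_gt0// ltr_pwDl.
have [s [c [us]]] := Cstar_red_approx TA e_gt0; set S := \sum_(g <- s) _ => TS.
have cs : \sum_(g <- s) cmod (c g) ^+ 2 <= e ^+ 2.
  apply: (@le_trans _ _ (ell2norm (S delta) ^+ 2)).
    rewrite -lee_fin ell2norm_sqr; apply: le_trans (sum_sqmod_uniq _ us).
    rewrite lee_fin le_eqVlt; apply/orP; left; apply/eqP; apply: eq_big_seq => g gs.
    rewrite cmod_sqr span_delta -big_filter (_ : [seq _ <- s | _] = [:: g]) ?big_seq1//.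
    by rewrite filter_pred1_uniq.
  rewrite ler_sqr ?nnegrE ?ell2norm_ge0 ?(ltW e_gt0)//.
  have := TS delta; rewrite -[(T - S) delta]/(T delta - S delta) Td sub0r ell2normN.
  move=> /le_trans; apply; rewrite -[leRHS]mulr1; apply: ler_wpM2l; first exact: ltW.
  exact: delta_norm.
have Sx : cmod (val (S x) h) <= e * (1 + X ^+ 2) / 2.
  rewrite span_coord; apply: (le_trans (cmod_sum _ _)).
  apply: (@le_trans _ _ (\sum_(g <- s) (e^-1 * cmod (c g) ^+ 2 + e * cmod (val x (g^-1 * h)%g) ^+ 2) / 2)).
    apply: ler_sum => g _; rewrite cmodM ler_pdivlMr// -subr_ge0.
    rewrite [X in 0 <= X](_ : _ = e^-1 * (cmod (c g) - e * cmod (val x (g^-1 * h)%g)) ^+ 2).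
      by rewrite mulr_ge0 ?sqr_ge0// invr_ge0 ltW.
    by field; rewrite gt_eqF.
  rewrite -mulr_suml ler_pM2r ?invr_gt0// big_split/= -!mulr_sumr [leRHS]mulrDr mulr1 lerD//.
    by rewrite mulrC ler_pdivrMr.
  rewrite ler_pM2l// -lee_fin ell2norm_sqr.
  under eq_bigr do rewrite cmod_sqr.
  rewrite -(big_map (fun g => g^-1 * h)%g predT (fun k => sqmod (val x k))).
  by apply: sum_sqmod_uniq; rewrite map_inj_uniq// => g g' /mulIg /invg_inj.
have Dx : cmod (val ((T - S) x) h) <= e * X.
  apply: le_trans (TS x); rewrite -ler_sqr ?nnegrE ?cmod_ge0 ?ell2norm_ge0// cmod_sqr.
  exact: ell2_coord.
have -> : val (T x) h = val ((T - S) x) h + val (S x) h.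
  by rewrite -[(T - S) x]/(T x - S x) ell2DE ell2NE subrK.
apply: le_trans (_ : e * X + e * (1 + X ^+ 2) / 2 <= _).
  have := cmod_sum [:: val ((T - S) x) h; val (S x) h] id; rewrite !big_cons !big_nil !addr0.
  by move=> /le_trans; apply; exact: lerD.
have -> : e0 = e * (1 + X) ^+ 2 by rewrite divfK// expf_neq0// gt_eqF// ltr_pwDl.
rewrite -mulrA -mulrDr ler_pM2l// -subr_ge0.
rewrite [X in 0 <= X](_ : _ = (1 + X) ^+ 2 / 2); last by field.
by rewrite divr_ge0// sqr_ge0.
Qed.

Lemma closed_ideal_average (I : set (H -> H)) (J : Type) (r : seq J) (F : J -> H -> H) :
  closed_ideal (@Cstar_red R G) I -> (forall j, I (F j)) -> I (average r F).
Proof.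
move=> [_ I0 ID IZ _] IF; apply: IZ.
by elim/big_ind: _.
Qed.

Lemma average_linear_span s (t : seq G) c x :
  average t (fun g => lambda g ((\sum_(f <- s) c f *: lambda f) (lambda g^-1%g x))) =
  \sum_(f <- s) c f *: conj_average R t f x.
Proof.
rewrite /conj_average /average.
under [RHS]eq_bigr do rewrite scalerA mulrC -scalerA.
rewrite -scaler_sumr; congr (_ *: _).
apply: val_inj; apply/funext => h; rewrite !ell2_sumE.
under eq_bigr do rewrite leftregE span_coord.
rewrite exchange_big; apply: eq_bigr => f _.
rewrite ell2ZE fct_sumE ell2_sumE mulr_sumr; apply: eq_bigr => g _.
by rewrite !leftregE invgK !invgM invgK !mulgA.
Qed.

End OperatorAlgebra.

(** * Simplicity *)

Section PowersImpliesSimple.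
Variables (R : realType) (G : groupType).
Local Notation H := (ell2 R G).
Local Notation lambda := (@leftreg R G).
Hypothesis powers : forall (L : seq G) (e : R), 0 < e -> (forall f, f \in L -> f != 1%g) ->
  exists2 t : seq G, t != [::] & forall f, f \in L -> opbound (conj_average R t f) e.

(** Averaging by conjugation keeps the trace part of an approximant of [T], while
    Powers' property makes the remaining finitely many terms small. The three
    errors are the deviation of the trace from $1$, the averaged nontrivial terms,
    and the approximation itself. *)
Lemma average_close_to_id (T : H -> H) (e : R) : Cstar_red T -> val (T (delta R G)) 1%g = 1 ->
  0 < e -> exists t : seq G,
    opbound (idfun - average t (fun g => lambda g \o T \o lambda g^-1%g)) (e + e + e).
Proof.
move=> TA T1 e0; have [s [c [_]]] := Cstar_red_approx TA e0.
set S := \sum_(g <- s) _ => TS.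
pose L := [seq g <- s | g != 1%g].
pose M := \sum_(g <- L) cmod (c g).
have M0 : 0 <= M by apply: sumr_ge0 => g _; exact: cmod_ge0.
have M1 : 0 < M + 1 by rewrite ltr_wpDl.
(* [M + 1] instead of [M], which may vanish. *)
have [||t t0 tL] := @powers L (e / (M + 1)); first by rewrite divr_gt0.
  by move=> f; rewrite mem_filter => /andP[].
exists t.
pose z := \sum_(g <- s | g == 1%g) c g.
have zE : z = val (S (delta R G)) 1%g by rewrite span_delta.
have z1 : cmod (1 - z) <= e.
  rewrite -ler_sqr ?nnegrE ?cmod_ge0 ?(ltW e0)// cmod_sqr zE -T1.
  have := ell2_coord ((T - S) (delta R G)) 1%g.
  rewrite -[(T - S) (delta R G)]/(T (delta R G) - S (delta R G)) ell2DE ell2NE => /le_trans; apply.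
  rewrite ler_sqr ?nnegrE ?ell2norm_ge0 ?(ltW e0)//; apply: (le_trans (TS _)).
  by rewrite -[leRHS]mulr1 ler_pM2l// delta_norm.
pose D := average t (fun g => lambda g \o (T - S) \o lambda g^-1%g).
pose B := \sum_(f <- L) c f *: conj_average R t f.
have -> : idfun - average t (fun g => lambda g \o T \o lambda g^-1%g)
    = (1 - z) *: idfun + - B + - D.
  apply/funext => x.
  suff : average t (fun g => lambda g (T (lambda g^-1%g x))) = z *: x + B x + D x.
    move=> eqx; rewrite -[LHS]/(x - average t (fun g => lambda g \o T \o lambda g^-1%g) x).
    rewrite averageE eqx -[RHS]/((1 - z) *: x - B x - D x) scalerBl scale1r.
    by rewrite !opprD !addrA.
  have -> : z *: x + B x = average t (fun g => lambda g (S (lambda g^-1%g x))).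
    rewrite average_linear_span (bigID (fun g => g == 1%g))/=; congr (_ + _).
      rewrite /z scaler_suml; apply: eq_bigr => g /eqP ->; congr (_ *: _).
      rewrite /conj_average averageE -[LHS](average_cst (s := t)) ?lt0n ?size_eq0//.
      by apply: eq_average => h _; rewrite mulg1 mulgV leftreg1.
    by rewrite /B big_filter fct_sumE.
  rewrite /D averageE /average -scalerDr -big_split/=; congr (_ *: _); apply: eq_bigr => g _.
  rewrite -[X in lambda g (T X)]/(lambda g^-1%g x); set y := lambda g^-1%g x.
  rewrite -[(T - S) y]/(T y - S y).
  have := leftreg_linear g 1 (S y) (T y - S y); rewrite !scale1r => <-.
  by rewrite addrC subrK.
have bN (U : H -> H) b : opbound U b -> opbound (- U) b by move=> Ub x; rewrite ell2normN.
apply: opboundD; [apply: opboundD|].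
- rewrite -[e]mulr1; apply: opboundW (opboundZ (1 - z) (_ : opbound idfun 1)).
    by rewrite !mulr1.
  by move=> x; rewrite mul1r.
- apply: bN; apply: (@opboundW _ _ _ (\sum_(f <- L) cmod (c f) * (e / (M + 1)))).
    rewrite -mulr_suml -/M mulrA mulrAC ler_piMl ?(ltW e0)//.
    by rewrite ler_pdivrMr// mul1r lerDl.
  by apply: opbound_sum => f fL; apply: opboundZ; exact: tL.
- apply: bN; apply: opbound_average => // g _ x /=.
  by rewrite leftreg_norm; apply: (le_trans (TS _)); rewrite leftreg_norm.
Qed.

(** A nonzero element of an ideal has a nonzero coordinate at the identity after
    a translation, so a multiple of trace $1$; its conjugation averages stay in
    the ideal and come arbitrarily close to the identity, which therefore belongs
    to the closed ideal. *)
Theorem Cstar_simple_of_powers : Cstar_simple R G.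
Proof.
move=> I Iideal; have [IA I0 ID IZ [IL IR Icl]] := Iideal.
have [In0|] := pselect (exists2 T, I T & T <> 0); last first.
  move=> nI; left; apply/seteqP; split=> [T IT|_ ->//].
  by apply: contrapT => T0; apply: nI; exists T.
right; apply/seteqP; split=> // S SA.
suff Iid : I idfun by rewrite (_ : S = S \o idfun)//; exact: IL.
apply: Icl; split; first exact: id_Cstar_red.
have [T IT T0] := In0.
have [h Th] : exists h, val (T (delta R G)) h <> 0.
  apply/existsNP => Th; apply: T0; apply: Cstar_red_delta_eq0; first exact: IA.
  by apply: val_inj; apply/funext => h; rewrite Th.
pose T1 := (val (T (delta R G)) h)^-1 *: (lambda h^-1%g \o T).
have IT1 : I T1 := IZ _ _ (IL _ _ (leftreg_Cstar_red _ _) IT).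
have T11 : val (T1 (delta R G)) 1%g = 1.
  by rewrite ell2ZE leftregE invgK mulg1 mulVf//; apply/eqP.
split; first by have [] := id_Cstar_red R G.
move=> e e0; have e3 : 0 < e / 3 by rewrite divr_gt0.
have [t tb] := average_close_to_id (IA _ IT1) T11 e3.
exists (average t (fun g => lambda g \o T1 \o lambda g^-1%g)).
  apply: (closed_ideal_average _ Iideal) => g.
  exact: (IR _ _ (IL _ _ (leftreg_Cstar_red _ _) IT1) (leftreg_Cstar_red _ _)).
apply: opbound_opnorm; first exact: ltW.
by apply: opboundW tb; rewrite le_eqVlt; apply/orP; left; apply/eqP; field.
Qed.

End PowersImpliesSimple.

Theorem corollary1p3 (R : realType) (X : topologicalType)
    (G : groupClosed (homeo X)) :
  hausdorff_space X ->
  countable [set` G] ->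
  (forall U : set X, open U -> U !=set0 -> ~ amenable R (subgroup (rist G U))) ->
  Cstar_simple R (subgroup G).
Proof.
move=> hX _ namen; apply: Cstar_simple_of_powers => L e e0 L1.
exact: powers_averaging.
Qed.
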